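(* There exists a function $\beta:\mathbb{N}\to\mathbb{N}$ such that for every integer $\ell\ge 1$, all $n\le m$ and every access sequence $X=(x_1,\dots,x_m)\in[n]^m$, \[\mathsf{OPT}(X)\le \beta(\ell)\cdot \mathsf{UB}^{\ell}(X),\qquad\text{where}\qquad \mathsf{UB}^{\ell}(X)=\sum_{t=1}^{m}\ \min_{t'\in[t-\ell,t),\ t'\ge 1}\log\big(|x_t-x_{t'}|+\rho_t(x_{t'})\big).\]
   Context: Throughout, $\log(x)$ denotes $\log_2(\max\{2,x\})$. Keys are $[n]=\{1,\dots,n\}$, and access sequences $X\in[n]^m$ satisfy $m\ge n$. Dynamic BST model: a binary search tree on the keys $[n]$ is maintained; to serve access $x_t$ a single pointer starts at the root, and the algorithm performs pointer moves (to the parent or a child) and rotations, the pointer having to visit the node holding $x_t$; the cost of an access is the number of such elementary operations plus one. $\mathsf{OPT}(X)$ is the minimum total cost of serving $X$ over all (offline) BST algorithms, with arbitrary initial tree. For a key $a$ and time $t$, $\rho_t(a)$ is the number of distinct keys accessed strictly between the last time $s<t$ with $x_s=a$ and time $t$ (all keys are considered accessed at time $0$). For $t=1$ the range of $t'$ is empty; the corresponding term is interpreted as $\log n$. *)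

(* Defs.v *)
From Stdlib Require Import Reals ClassicalDescription.
From mathcomp Require Import all_boot.

Set Implicit Arguments.
Unset Strict Implicit.
Unset Printing Implicit Defensive.

Inductive tree := Leaf | Node of tree & nat & tree.

Fixpoint inorder (t : tree) : seq nat :=
  match t with Leaf => [::] | Node l k r => inorder l ++ k :: inorder r end.

Definition is_bst (n : nat) (t : tree) : Prop := inorder t = iota 1 n.

(* pointer = path from the root; false = go to left child, true = right child *)
Fixpoint subtree_at (t : tree) (p : seq bool) : option tree :=
  match p with
  | [::] => Some t
  | d :: p' => match t with
               | Leaf => None
               | Node l _ r => subtree_at (if d then r else l) p'
               end
  end.

Fixpoint replace_at (t : tree) (p : seq bool) (s : tree) : tree :=
  match p with
  | [::] => s
  | d :: p' => match t with
               | Leaf => Leaf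
               | Node l k r =>
                   if d then Node l k (replace_at r p' s)
                   else Node (replace_at l p' s) k r
               end
  end.

Definition key_at (t : tree) (p : seq bool) : option nat :=
  match subtree_at t p with Some (Node _ k _) => Some k | _ => None end.

Definition config := (tree * seq bool)%type.

(* one elementary operation: move pointer to parent / left child / right child,
   or rotate the pointer node with its parent (the pointer stays on its node) *)
Inductive step : config -> config -> Prop :=
| st_up : forall t q d k,
    key_at t (rcons q d) = Some k -> step (t, rcons q d) (t, q)
| st_left : forall t p l k r,
    subtree_at t p = Some (Node l k r) -> l <> Leaf ->
    step (t, p) (t, rcons p false)
| st_right : forall t p l k r,
    subtree_at t p = Some (Node l k r) -> r <> Leaf ->
    step (t, p) (t, rcons p true)
| st_rot_right : forall t q a x b y c,
    subtree_at t q = Some (Node (Node a x b) y c) ->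
    step (t, rcons q false) (replace_at t q (Node a x (Node b y c)), q)
| st_rot_left : forall t q a y b x c,
    subtree_at t q = Some (Node a y (Node b x c)) ->
    step (t, rcons q true) (replace_at t q (Node (Node a y b) x c), q).

Fixpoint chain (c : config) (cs : seq config) : Prop :=
  match cs with
  | [::] => True
  | c' :: cs' => step c c' /\ chain c' cs'
  end.

(* serving access x from tree T with the list of configurations cs reached
   after each elementary operation (pointer starts at the root); the pointer
   must visit the node holding x. Cost = number of operations + 1. *)
Definition serves (T : tree) (x : nat) (cs : seq config) : Prop :=
  chain (T, [::]) cs /\
  exists2 i, (i <= size cs)%N &
    let c := nth (T, [::]) ((T, [::]) :: cs) i in key_at c.1 c.2 = Some x.

Fixpoint exec (T : tree) (X : seq nat) (c : nat) : Prop :=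
  match X with
  | [::] => c = 0
  | x :: X' => exists cs, serves T x cs /\
       exists c', c = (size cs).+1 + c' /\ exec (last (T, [::]) cs).1 X' c'
  end.

Definition opt_cost (n : nat) (X : seq nat) (c : nat) : Prop :=
  exists T0, is_bst n T0 /\ exec T0 X c.

Definition opt_costb (n : nat) (X : seq nat) : pred nat :=
  fun c => if excluded_middle_informative (opt_cost n X c) then true else false.

Lemma opt_costb_ex n X : (exists c, opt_cost n X c) -> exists c, opt_costb n X c.
Proof.
move=> [c Hc]; exists c; rewrite /opt_costb.
by case: excluded_middle_informative.
Qed.

(* OPT(X): minimum total cost over all (offline) BST executions with
   arbitrary initial BST on [n] (0 if no execution exists, which never
   happens for valid inputs). *)
Definition OPT (n : nat) (X : seq nat) : nat :=
  match excluded_middle_informative (exists c, opt_cost n X c) with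
  | left h => ex_minn (opt_costb_ex h)
  | right _ => 0
  end.

Open Scope R_scope.

Definition lg (x : R) : R := ln (Rmax 2 x) / ln 2.

Close Scope R_scope.

(* x_t, 1-indexed *)
Definition acc (X : seq nat) (t : nat) : nat := nth 0 X t.-1.

(* last time s < t with x_s = a, or 0 (all keys accessed at time 0) *)
Definition last_acc (X : seq nat) (a t : nat) : nat :=
  \max_(1 <= s < t | acc X s == a) s.

(* rho_t(a): number of distinct keys accessed at times strictly between
   last_acc X a t and t *)
Definition rho (X : seq nat) (t a : nat) : nat :=
  let s := last_acc X a t in size (undup (take (t.-1 - s) (drop s X))).

Definition distn (a b : nat) : nat := (a - b) + (b - a).

Open Scope R_scope.

Definition ub_term (l n : nat) (X : seq nat) (t : nat) : R :=
  let f := fun t' : nat =>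
    lg (INR (distn (acc X t) (acc X t') + rho X t (acc X t'))) in
  match [seq t' <- iota 1 t.-1 | (t <= t' + l)%N] with
  | [::] => lg (INR n)
  | t0 :: ts => foldr (fun t' acc => Rmin (f t') acc) (f t0) ts
  end.

Definition UB (l n : nat) (X : seq nat) : R :=
  \big[Rplus/0]_(1 <= t < (size X).+1) ub_term l n X t.

Close Scope R_scope.

(* Main.v *)
Require Import Defs.
From Stdlib Require Import Reals Lra ClassicalDescription IndefiniteDescription.
From mathcomp Require Import all_boot zify.

(* Give the key i the level v_2(i + s), so that the levels are those of a dyadic
   tree shifted by s, and let the height of [a..b] be its highest level.  On
   average over s, the height of [a..b] is at most log |b - a| + O(1), so some s
   is good for the sum over the pairs (x_t, x_t') that realize the minima.

   The last l accesses are kept as fingers.  The shape of the tree is a function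
   of the set of fingers only: the gap between two consecutive fingers is a
   treap for the levels, unfolded so that it is shallow near both fingers.  A
   new finger splits a gap into two; the larger of their heights is the height
   of the old gap, and the split costs O(1 + the smaller one).  Rotations being
   reversible, dropping the oldest finger merges two gaps at the same price.
   The sum of the heights of the gaps, as a potential, grows at a split by the
   smaller height and falls back at a merge, so splits pay for merges.  The
   split caused by x_t costs O(1 + the height between x_t and any given
   finger), in particular x_t'. *)

Set Implicit Arguments.
Unset Strict Implicit.
Unset Printing Implicit Defensive.

(** * Restructuring a tree by rotations *)

(* [conv k s t]: at most [k] elementary operations turn [s] into [t], with the
   pointer at the root before and after.  As a relation between trees, it is
   symmetric with no loss in [k]. *)
Inductive conv : nat -> tree -> tree -> Prop :=
| conv_refl k t : conv k t t
| conv_trans k1 k2 s t u : conv k1 s t -> conv k2 t u -> conv (k1 + k2) s u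
| conv_rotr a x b y c :
    conv 2 (Node (Node a x b) y c) (Node a x (Node b y c))
| conv_rotl a x b y c :
    conv 2 (Node a x (Node b y c)) (Node (Node a x b) y c)
| conv_left k l l' x r : conv k l l' -> conv k.+2 (Node l x r) (Node l' x r)
| conv_right k l x r r' : conv k r r' -> conv k.+2 (Node l x r) (Node l x r').

Lemma conv_sym k s t : conv k s t -> conv k t s.
Proof.
elim=> [k' t'|k1 k2 ? ? ? _ IH1 _ IH2|*|*|*|*].
- exact: conv_refl.
- by rewrite addnC; apply: conv_trans IH2 IH1.
- exact: conv_rotl.
- exact: conv_rotr.
- exact: conv_left.
- exact: conv_right.
Qed.

Lemma conv_le k k' s t : k <= k' -> conv k s t -> conv k' s t.
Proof.
by move=> le_kk' st; rewrite -(subnKC le_kk'); apply: conv_trans st (conv_refl _ _).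
Qed.

Lemma conv_comp k1 k2 k s t u :
  conv k1 s t -> conv k2 t u -> k1 + k2 <= k -> conv k s u.
Proof. by move=> st tu le_k; apply: conv_le le_k (conv_trans st tu). Qed.

Lemma conv_inorder k s t : conv k s t -> inorder s = inorder t.
Proof.
elim=> //= [? ? ? ? ? _ -> _ -> //|*|*|? ? ? ? ? _ ->|? ? ? ? ? _ ->] //;
  by rewrite -catA.
Qed.

(** A rotation neither creates nor removes nodes. [conv_chain] relies on this because the pointer
    cannot enter a leaf. *)
Lemma conv_Leaf k s t : conv k s t -> s = Leaf <-> t = Leaf.
Proof.
elim=> {k s t} [k t|k1 k2 s t u _ IH1 _ IH2|a x b y c|a x b y c|k l l' x r _ _|k l x r r' _ _];
  by [|rewrite IH1].
Qed.

(** * Realizing a restructuring by pointer operations *)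

Lemma subtree_at0 T : subtree_at T [::] = Some T.
Proof. by case: T. Qed.

Lemma subtree_at_cat T p q :
  subtree_at T (p ++ q) = obind (fun t => subtree_at t q) (subtree_at T p).
Proof. by elim: p T => [|d p IH] [|l k r] //=; case: q. Qed.

Lemma subtree_at_rcons T p d l k r :
  subtree_at T p = Some (Node l k r) ->
  subtree_at T (rcons p d) = Some (if d then r else l).
Proof. by move=> Tp; rewrite -cats1 subtree_at_cat Tp /= subtree_at0. Qed.

Lemma replace_at0 T s : replace_at T [::] s = s.
Proof. by case: T. Qed.

Lemma subtree_replace_at T q t u :
  subtree_at T q = Some t -> subtree_at (replace_at T q u) q = Some u.
Proof.
elim: q T => [|d q IH] T; first by rewrite replace_at0 !subtree_at0.
by case: T => [|l k r] //=; case: d => /= /IH.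
Qed.

Lemma replace_at_id T q t : subtree_at T q = Some t -> replace_at T q t = T.
Proof.
elim: q T => [|d q IH] T; first by rewrite replace_at0 subtree_at0 => -[].
by case: T => [|l k r] //=; case: d => /= /IH ->.
Qed.

Lemma replace_at_twice T q t u w : subtree_at T q = Some t ->
  replace_at (replace_at T q u) q w = replace_at T q w.
Proof.
elim: q T => [|d q IH] T; first by rewrite !replace_at0.
by case: T => [|l k r] //=; case: d => /= /IH ->.
Qed.

Lemma replace_at_rcons T q d l k r u :
  subtree_at T q = Some (Node l k r) ->
  replace_at T (rcons q d) u =
  replace_at T q (if d then Node l k u else Node u k r).
Proof.
elim: q T => [|d' q IH] T.
  by rewrite subtree_at0 replace_at0 => -[->] /=; rewrite !replace_at0.
by case: T => [|l' k' r'] //=; case: d' => /= /IH ->.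
Qed.

Lemma chain_cat c cs1 cs2 :
  chain c cs1 -> chain (last c cs1) cs2 -> chain c (cs1 ++ cs2).
Proof. by elim: cs1 c => //= c1 cs1 IH c [st /IH{}IH] /IH. Qed.

(** A rotation costs a descent to the child plus the rotation itself; work inside a child costs a
    descent and a return. Inside an empty child nothing is done. *)
Lemma conv_chain k s t : conv k s t -> forall T q, subtree_at T q = Some s ->
  exists cs, [/\ chain (T, q) cs, size cs <= k
    & last (T, q) cs = (replace_at T q t, q)].
Proof.
elim=> {k s t}
  [k t|k1 k2 s t u _ IH1 _ IH2|a x b y c|a x b y c|k l l' x r ll' IH|k l x r r' rr' IH] T q Tq.
- by exists [::]; split=> //=; rewrite (replace_at_id Tq).
- have [cs1 [ch1 sz1 l1]] := IH1 T q Tq.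
  have [cs2 [ch2 sz2 l2]] := IH2 _ _ (subtree_replace_at t Tq).
  exists (cs1 ++ cs2); split; first by apply: chain_cat => //; rewrite l1.
    by rewrite size_cat leq_add.
  by rewrite last_cat l1 l2 (replace_at_twice _ _ Tq).
- exists [:: (T, rcons q false); (replace_at T q (Node a x (Node b y c)), q)].
  by split=> //=; split; [exact: st_left Tq _|split=> //; exact: st_rot_right].
- exists [:: (T, rcons q true); (replace_at T q (Node (Node a x b) y c), q)].
  by split=> //=; split; [exact: st_right Tq _|split=> //; exact: st_rot_left].
- have leafE := conv_Leaf ll'; have Tl := subtree_at_rcons false Tq.
  case El: l' => [|l1 k1 r1].
    move: Tq; rewrite (leafE.2 El) => Tq.
    by exists [::]; rewrite /= (replace_at_id Tq).
  have [cs [ch sz lst]] := IH _ _ Tl.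
  exists ((T, rcons q false) :: rcons cs (replace_at T q (Node l' x r), q)).
  rewrite /= size_rcons last_rcons El; split=> //.
  split; first by apply: st_left Tq _ => /leafE; rewrite El.
  rewrite -[rcons cs _]cats1; apply: chain_cat => //; rewrite lst /=; split=> //.
  rewrite (replace_at_rcons false _ Tq) El.
  apply: (st_up (k := k1)); rewrite /key_at.
  by rewrite (subtree_at_rcons false (subtree_replace_at _ Tq)).
- have leafE := conv_Leaf rr'; have Tr := subtree_at_rcons true Tq.
  case Er: r' => [|l1 k1 r1].
    move: Tq; rewrite (leafE.2 Er) => Tq.
    by exists [::]; rewrite /= (replace_at_id Tq).
  have [cs [ch sz lst]] := IH _ _ Tr.
  exists ((T, rcons q true) :: rcons cs (replace_at T q (Node l x r'), q)).
  rewrite /= size_rcons last_rcons Er; split=> //.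
  split; first by apply: st_right Tq _ => /leafE; rewrite Er.
  rewrite -[rcons cs _]cats1; apply: chain_cat => //; rewrite lst /=; split=> //.
  rewrite (replace_at_rcons true _ Tq) Er.
  apply: (st_up (k := k1)); rewrite /key_at.
  by rewrite (subtree_at_rcons true (subtree_replace_at _ Tq)).
Qed.

Lemma chain_descend T p k : key_at T p = Some k ->
  exists cs, [/\ chain (T, [::]) cs, size cs = size p
    & last (T, [::]) cs = (T, p)].
Proof.
elim/last_ind: p k => [|p d IH] k; first by exists [::].
rewrite /key_at -cats1 subtree_at_cat.
case Tp: (subtree_at T p) => [[|l k' r]|] //= Hk.
have [|cs [ch sz lst]] := IH k'; first by rewrite /key_at Tp.
exists (rcons cs (T, rcons p d)).
rewrite size_rcons last_rcons sz cats1 size_rcons; split=> //.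
rewrite -cats1; apply: chain_cat => //=; rewrite lst; split=> //.
by case: d Hk => Hk; [apply: st_right Tp _|apply: st_left Tp _];
  move=> E; move: Hk; rewrite E.
Qed.

(** Restructure at the root first, then walk down to [x]. The walk is not undone, since the next
    access starts at the root again. *)
Lemma serves_conv k T T' p x : conv k T T' -> key_at T' p = Some x ->
  exists cs, [/\ serves T x cs, size cs <= k + size p
    & (last (T, [::]) cs).1 = T'].
Proof.
move=> TT' xp; have [cs1 [ch1 sz1 l1]] := conv_chain TT' (subtree_at0 T).
have [cs2 [ch2 sz2 l2]] := chain_descend xp.
exists (cs1 ++ cs2); rewrite last_cat l1 replace_at0 l2 size_cat; split=> //; last first.
  by rewrite sz2 leq_add2r.
split; first by apply: chain_cat => //; rewrite l1 replace_at0.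
exists (size (cs1 ++ cs2)) => //.
have -> : nth (T, [::]) ((T, [::]) :: cs1 ++ cs2) (size (cs1 ++ cs2)) = (T', p).
  rewrite -[size _]/((size ((T, [::]) :: cs1 ++ cs2)).-1) nth_last /=.
  by rewrite last_cat l1 replace_at0 l2.
by [].
Qed.

(** * Treaps whose priorities are the levels of the keys *)

(* In all that follows, the direction [d] selects one of two mirror images. *)
Definition nd (d : bool) l x r := if d then Node r x l else Node l x r.

(** [a] is the near end: the smaller key for [d = false], the larger one for [d = true]. *)
Definition btw (d : bool) a x b := if d then b < x < a else a < x < b.

Lemma conv_rot d a x b y c :
  conv 2 (nd d (nd d a x b) y c) (nd d a x (nd d b y c)).
Proof. by case: d; [apply: conv_rotl|apply: conv_rotr]. Qed.

Lemma conv_near d k l l' x r :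
  conv k l l' -> conv k.+2 (nd d l x r) (nd d l' x r).
Proof. by case: d; [apply: conv_right|apply: conv_left]. Qed.

Lemma conv_far d k l x r r' :
  conv k r r' -> conv k.+2 (nd d l x r) (nd d l x r').
Proof. by case: d; [apply: conv_left|apply: conv_right]. Qed.

(* [comb_onto d t x u] is [nd d t x u] after rotating the near spine of [t]
   into a comb, so that the nodes close to the near end become shallow. *)
Fixpoint comb_onto d t x u :=
  if t is Node l y r then
    if d then comb_onto d r y (nd d l x u) else comb_onto d l y (nd d r x u)
  else nd d Leaf x u.

Definition comb d t :=
  if t is Node l y r then
    if d then comb_onto d r y l else comb_onto d l y r
  else Leaf.

Lemma comb_onto_nd d l y r x u :
  comb_onto d (nd d l y r) x u = comb_onto d l y (nd d r x u).
Proof. by case: d. Qed.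

Lemma comb_nd d l y r : comb d (nd d l y r) = comb_onto d l y r.
Proof. by case: d. Qed.

Section Level.

Variable v : nat -> nat.
(** Makes the highest key of every interval unique, hence the treaps canonical with strictly
    decreasing levels. *)
Hypothesis v_between :
  forall a b, a < b -> v a = v b -> exists2 c, a < c < b & v a < v c.

Definition is_top a b c := a <= c <= b /\ forall i, a <= i <= b -> v i <= v c.

Fixpoint top_from a k :=
  if k is k'.+1 then
    let c := top_from a k' in if v c < v (a + k) then a + k else c
  else a.

Definition top a b := top_from a (b - a).

Lemma topP a b : a <= b -> is_top a b (top a b).
Proof.
rewrite /top => /subnKC <-; rewrite addKn; move: (b - a) => k.
elim: k => [|k [bk Hk]] /=.
  by split=> [|i Hi]; [lia|have -> : i = a by lia].
case: ltnP => Hv; split; try lia; move=> i Hi;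
  have [->//|ne] := eqVneq i (a + k.+1).
- by apply: leq_trans (ltnW Hv); apply: Hk; lia.
- by apply: Hk; lia.
Qed.

Lemma is_top_uniq a b c c' : is_top a b c -> is_top a b c' -> c = c'.
Proof.
move=> [ci ct] [ci' ct']; have E : v c = v c'.
  by apply/eqP; rewrite eqn_leq ct' // ct.
case: (ltngtP c c') => // lt.
- have [e ei] := v_between lt E; rewrite ltnNge ct //; lia.
- have [e ei] := v_between lt (esym E); rewrite ltnNge ct' //; lia.
Qed.

Lemma top_eq a b c : is_top a b c -> top a b = c.
Proof.
move=> tc; apply: is_top_uniq (tc); apply: topP.
by case: tc => /andP[ac cb] _; apply: leq_trans cb.
Qed.

(** The endpoints are excluded. [k] is fuel: by [treap_fuel_eq], every [k >= b - a] gives the same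
    tree. *)
Fixpoint treap_fuel k a b :=
  if k is k'.+1 then
    if a.+1 < b then
      let r := top a.+1 b.-1 in Node (treap_fuel k' a r) r (treap_fuel k' r b)
    else Leaf
  else Leaf.

Lemma treap_fuel_eq k k' a b : b - a <= k -> b - a <= k' ->
  treap_fuel k a b = treap_fuel k' a b.
Proof.
elim: k k' a b => [|k IH] [|k'] a b //= Hk Hk'; case: ifP => //; try lia.
move=> ab; have [Hr _] : is_top a.+1 b.-1 (top a.+1 b.-1) by apply: topP; lia.
by congr Node; apply: IH; lia.
Qed.

Definition treap d a b := if d then treap_fuel a b a else treap_fuel b a b.

Lemma treap_nd d a r b : btw d a r b ->
  (forall i, btw d a i b -> v i <= v r) ->
  treap d a b = nd d (treap d a r) r (treap d r b).
Proof.
have main a' b' : a' < r < b' -> (forall i, a' < i < b' -> v i <= v r) ->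
    treap_fuel b' a' b' = Node (treap_fuel r a' r) r (treap_fuel b' r b').
  move=> Hr Hi; have -> : treap_fuel b' a' b' = treap_fuel b'.+1 a' b'.
    by apply: treap_fuel_eq; lia.
  rewrite /= ifT; last by lia.
  have -> : top a'.+1 b'.-1 = r.
    by apply: top_eq; split=> [|i ?]; [lia|apply: Hi; lia].
  by congr Node; apply: treap_fuel_eq; lia.
by case: d => /= Hr Hi; apply: main.
Qed.

Lemma treap_leaf d a b : (forall i, ~~ btw d a i b) -> treap d a b = Leaf.
Proof.
have main a' b' : (forall i, ~~ (a' < i < b')) -> treap_fuel b' a' b' = Leaf.
  by move=> /(_ a'.+1) Hi; case: b' Hi => //= b' Hi; rewrite ifF //; lia.
by case: d => /= Hi; apply: main.
Qed.

Lemma treap_root d a x b : btw d a x b -> exists r, [/\ btw d a r b,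
  forall i, btw d a i b -> i != r -> v i < v r
  & treap d a b = nd d (treap d a r) r (treap d r b)].
Proof.
have main a' b' : a' < x < b' -> exists2 r, a' < r < b' &
    forall i, a' < i < b' -> i != r -> v i < v r.
  move=> Hx; have Ht : is_top a'.+1 b'.-1 (top a'.+1 b'.-1) by apply: topP; lia.
  exists (top a'.+1 b'.-1); first by case: Ht; lia.
  move=> i Hi; apply: contraNT; rewrite -leqNgt => le_v; apply/eqP.
  apply: is_top_uniq (Ht); split; first by lia.
  by move=> j Hj; apply: leq_trans le_v; apply: Ht.2.
move=> Hx; have [r rI rT] : exists2 r, btw d a r b &
    forall i, btw d a i b -> i != r -> v i < v r.
  by case: d Hx => /=; apply: main.
exists r; split=> //; apply: treap_nd => // i Hi.
by have [->//|ne] := eqVneq i r; apply: ltnW; apply: rT.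
Qed.

(** Levels strictly decrease downwards, so fewer than [m] rotations bring [x] to the root, and
    treaps remain on both sides. Each level costs 2 for the rotation and 2 for the descent and
    return. *)
Lemma treap_split d m a x b : btw d a x b ->
  (forall i, btw d a i b -> v i < m) ->
  conv (4 * m) (treap d a b) (nd d (treap d a x) x (treap d x b)).
Proof.
elim: m a b => [|m IH] a b Hx Hm; first by have := Hm _ Hx.
have [r [Hr rT ->]] := treap_root Hx.
have Hlt i : btw d a i b -> i != r -> v i < m.
  by move=> Hi /(rT _ Hi) lt; have := Hm _ Hr; lia.
have Hle i : btw d a i b -> v i <= v r.
  by move=> Hi; have [->//|ne] := eqVneq i r; apply: ltnW; apply: rT.
have [->|ne] := eqVneq x r; first exact: conv_refl.
have [Hxr|Hxr] : btw d a x r \/ btw d r x b by case: (d) Hx Hr ne => /=; lia.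
- have st : conv (4 * m) (treap d a r) (nd d (treap d a x) x (treap d x r)).
    by apply: IH => // i Hi; apply: Hlt; case: (d) Hi Hr => /=; lia.
  rewrite (treap_nd (r := r) (a := x)).
  + apply: conv_comp (conv_near _ _ _ st) (conv_rot _ _ _ _ _ _) _; lia.
  + by case: (d) Hxr Hr => /=; lia.
  + by move=> i Hi; apply: Hle; case: (d) Hi Hx => /=; lia.
- have st : conv (4 * m) (treap d r b) (nd d (treap d r x) x (treap d x b)).
    by apply: IH => // i Hi; apply: Hlt; case: (d) Hi Hr => /=; lia.
  rewrite (treap_nd (r := r) (b := x)).
  + apply: conv_comp (conv_far _ _ _ st) (conv_sym (conv_rot _ _ _ _ _ _)) _; lia.
  + by case: (d) Hxr Hr => /=; lia.
  + by move=> i Hi; apply: Hle; case: (d) Hi Hx => /=; lia.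
Qed.

Lemma btw_dec d a b : (exists y, btw d a y b) \/ (forall y, ~~ btw d a y b).
Proof.
case: (boolP (if d then b.+1 < a else a.+1 < b)) => H.
  by left; exists (if d then b.+1 else a.+1); case: (d) H => /=; lia.
by right=> y; case: (d) H => /=; lia.
Qed.

(** Each rotation is at the root and brings up a spine key of strictly smaller level, so at most [m]
    are made. *)
Lemma conv_comb_onto d m a b x u : (forall i, btw d a i b -> v i < m) ->
  conv (2 * m) (nd d (treap d a b) x u) (comb_onto d (treap d a b) x u).
Proof.
elim: m b x u => [|m IH] b x u Hm; have [[y Hy]|no] := btw_dec d a b;
  try by rewrite (treap_leaf no); case: (d); apply: conv_refl.
  by have := Hm _ Hy.
have [r [Hr rT ->]] := treap_root Hy.
rewrite comb_onto_nd; apply: conv_comp (conv_rot _ _ _ _ _ _) (IH _ _ _ _) _; last by lia.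
move=> i Hi; have [Hib /(rT _ Hib) lt] : btw d a i b /\ i != r.
  by case: (d) Hi Hr => /=; lia.
by have := Hm _ Hr; lia.
Qed.

Lemma conv_comb d m a b : (forall i, btw d a i b -> v i < m) ->
  conv (2 * m) (treap d a b) (comb d (treap d a b)).
Proof.
move=> Hm; have [[y Hy]|no] := btw_dec d a b; last first.
  by rewrite (treap_leaf no); apply: conv_refl.
have [r [Hr rT ->]] := treap_root Hy; rewrite comb_nd.
apply: conv_comb_onto => i Hi; apply: Hm.
by case: (d) Hi Hr => /=; lia.
Qed.

(** Near-spine keys of level at least [m] lie beyond [x], so they are also on the spine of
    [treap d x b], with the same far subtrees. They go unchanged into the accumulator [u], and only
    the part of levels below [m] has to be rebuilt. *)
Lemma comb_onto_split d m a x b y u : btw d a x b ->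
  (forall i, btw d a i x || (i == x) -> v i < m) ->
  conv (8 * m + 6) (comb_onto d (treap d a b) y u)
                   (nd d (treap d a x) x (comb_onto d (treap d x b) y u)).
Proof.
move=> Hx Hm; have [n] := ubnP (if d then a - b else b - a).
elim: n => // n IH in b y u Hx *; move=> Hn.
have [r [Hr rT E]] := treap_root Hx.
have Hle i : btw d a i b -> v i <= v r.
  by move=> Hi; have [->//|ne] := eqVneq i r; apply: ltnW; apply: rT.
have [lt_m|ge_m] := ltnP (v r) m.
  have Hm' i : btw d a i b -> v i < m by move=> /Hle; lia.
  have Hm'' i : btw d x i b -> v i < m.
    by move=> Hi; apply: Hm'; case: (d) Hi Hx => /=; lia.
  (* Fold the comb back ([2 * m]), split one level down ([4 * m + 2]), rotate [x] above [y] (2), and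
     comb the far half again ([2 * m + 2]). *)
  apply: (conv_comp (k1 := 2 * m) (k2 := 6 * m + 6)); last by lia.
    by apply: conv_sym; apply: conv_comb_onto.
  apply: (conv_comp (k1 := 4 * m + 2) (k2 := 2 * m + 4)); last by lia.
    by rewrite addn2; apply: conv_near; apply: treap_split Hx Hm'.
  apply: conv_comp (conv_rot _ _ _ _ _ _) (conv_far _ _ _ (conv_comb_onto _ _ Hm'')) _.
  lia.
have Hxr : btw d a x r.
  have: ~~ (btw d a r x || (r == x)).
    by apply/negP => /Hm; rewrite ltnNge ge_m.
  by case: (d) Hx Hr => /=; lia.
rewrite E (treap_nd (a := x) (r := r)) ?comb_onto_nd.
- by apply: IH => //; case: (d) Hxr Hr Hn => /=; lia.
- by case: (d) Hxr Hr => /=; lia.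
- by move=> i Hi; apply: Hle; case: (d) Hi Hx => /=; lia.
Qed.

Lemma comb_split d m a x b : btw d a x b ->
  (forall i, btw d a i x || (i == x) -> v i < m) ->
  conv (8 * m + 6) (comb d (treap d a b))
                   (nd d (treap d a x) x (comb d (treap d x b))).
Proof.
move=> Hx Hm; have [r [Hr rT E]] := treap_root Hx.
have Hle i : btw d a i b -> v i <= v r.
  by move=> Hi; have [->//|ne] := eqVneq i r; apply: ltnW; apply: rT.
have [lt_m|ge_m] := ltnP (v r) m.
  have Hm' i : btw d a i b -> v i < m by move=> /Hle; lia.
  have Hm'' i : btw d x i b -> v i < m.
    by move=> Hi; apply: Hm'; case: (d) Hi Hx => /=; lia.
  apply: (conv_comp (k1 := 2 * m) (k2 := 6 * m + 6)); last by lia.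
    by apply: conv_sym; apply: conv_comb.
  apply: conv_comp (treap_split Hx Hm') (conv_far _ _ _ (conv_comb Hm'')) _.
  lia.
have Hxr : btw d a x r.
  have: ~~ (btw d a r x || (r == x)).
    by apply/negP => /Hm; rewrite ltnNge ge_m.
  by case: (d) Hx Hr => /=; lia.
rewrite E (treap_nd (a := x) (r := r)) ?comb_nd.
- exact: comb_onto_split.
- by case: (d) Hxr Hr => /=; lia.
- by move=> i Hi; apply: Hle; case: (d) Hi Hx => /=; lia.
Qed.

(** * Heights of closed intervals and the shape of a gap *)

Definition height a b := v (top a b).

Lemma height_ge a b i : a <= i <= b -> v i <= height a b.
Proof. by move=> Hi; have [|_ ->] := @topP a b; first lia. Qed.

Lemma height_leP a b m : a <= b ->
  height a b <= m <-> (forall i, a <= i <= b -> v i <= m).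
Proof.
move=> le_ab; split=> [le_m i Hi|]; first exact: leq_trans (height_ge Hi) le_m.
by apply; case: (topP le_ab).
Qed.

Lemma height_sub a b a' b' : a' <= a -> a <= b -> b <= b' ->
  height a b <= height a' b'.
Proof.
by move=> ? le_ab ?; apply/(height_leP _ le_ab) => i Hi; apply: height_ge; lia.
Qed.

Lemma height_max a x b : a <= x <= b ->
  height a b = maxn (height a x) (height x b).
Proof.
move=> Hx; apply/eqP; rewrite eqn_leq geq_max !height_sub ?andbT; try lia.
apply/height_leP => [|i Hi]; first lia.
rewrite leq_max; have [le_ix|lt_xi] := leqP i x.
  by rewrite height_ge //; lia.
by rewrite [v i <= height x b]height_ge ?orbT //; lia.
Qed.

(* Through the highest key [c] of the closed interval [f..g], each half of the
   gap is made shallow at its end of lower level, away from [c]. *)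
Definition gap f g :=
  let c := top f g in
  if c == g then comb false (treap false f g)
  else if c == f then comb true (treap true g f)
  else Node (comb false (treap false f c)) c (comb true (treap true g c)).

Definition gapd (d : bool) f g := if d then gap g f else gap f g.

Definition heightd (d : bool) f g := if d then height g f else height f g.

(** Needed for the piece that a split cuts off: it comes out as a plain treap. *)
Lemma conv_treap_gap m f g : f < g -> height f g < m ->
  conv (4 * m + 4) (treap false f g) (gap f g).
Proof.
move=> lt_fg Hm; have Hv i : f <= i <= g -> v i < m.
  by move=> Hi; apply: leq_ltn_trans Hm; apply: height_ge.
rewrite /gap; case: ifP => [_|/eqP ng].
  by apply: (@conv_le (2 * m)) (conv_comb _); [lia|move=> i /= Hi; apply: Hv; lia].
case: ifP => [_|/eqP nf].
  rewrite -[treap false f g]/(treap true g f).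
  by apply: (@conv_le (2 * m)) (conv_comb _); [lia|move=> i /= Hi; apply: Hv; lia].
have [] := topP (ltnW lt_fg); move: (top f g) nf ng => c nf ng Hc ct.
rewrite (treap_nd (d := false) (r := c)) /nd; first last.
- by move=> i /= Hi; apply: ct; lia.
- by rewrite /=; lia.
apply: (conv_comp (k1 := (2 * m).+2) (k2 := (2 * m).+2)); last by lia.
  by apply: conv_left; apply: conv_comb => i /= Hi; apply: Hv; lia.
rewrite -[treap false c g]/(treap true g c).
by apply: conv_right; apply: conv_comb => i /= Hi; apply: Hv; lia.
Qed.

Lemma gapd_far d f g : (if d then g < f else f < g) ->
  (forall i, btw d f i g || (i == f) -> v i <= v g) ->
  gapd d f g = comb d (treap d f g).
Proof.
have E a b c : is_top a b c -> top a b = c by apply: top_eq.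
case: d => /= lt Hg; rewrite /gap (E _ _ g) ?eqxx //.
- by rewrite ifF //; apply/eqP; lia.
- split=> [|i Hi]; first lia.
  by have [->//|ne] := eqVneq i g; apply: Hg; lia.
- split=> [|i Hi]; first lia.
  by have [->//|ne] := eqVneq i g; apply: Hg; lia.
Qed.

Lemma gapd_mid d f c g : btw d f c g ->
  (forall i, btw d f i g || (i == f) || (i == g) -> v i <= v c) ->
  gapd d f g = nd d (comb d (treap d f c)) c (comb (~~ d) (treap (~~ d) g c)).
Proof.
have E a b e : is_top a b e -> top a b = e by apply: top_eq.
case: d => /= Hc Ht; rewrite /gap (E _ _ c).
- by rewrite ifF ?ifF //; apply/eqP; lia.
- by split=> [|i Hi]; [lia|apply: Ht; lia].
- by rewrite ifF ?ifF //; apply/eqP; lia.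
- by split=> [|i Hi]; [lia|apply: Ht; lia].
Qed.

Lemma conv_treap_gapd m d f g : (if d then g < f else f < g) ->
  heightd d f g < m -> conv (4 * m + 4) (treap d f g) (gapd d f g).
Proof.
by case: d; [apply: (@conv_treap_gap m g f)|apply: conv_treap_gap].
Qed.

(** The top [c] is beyond [x], so it stays the top of the interval from [x] to [g]. Only the comb at
    the [f] end changes: [comb_split] cuts it at [x] and leaves the comb that the new far gap has
    there. *)
Lemma gapd_split d f x g c : btw d f x g -> btw d x c g || (c == g) ->
  (forall i, btw d f i g || (i == f) || (i == g) -> v i <= v c) ->
  conv (12 * heightd d f x + 40) (gapd d f g)
       (nd d (gapd d f x) x (gapd d x g)).
Proof.
move=> Hx Hc Ht; set m := (heightd d f x).+1.
have Hm i : btw d f i x || (i == f) || (i == x) -> v i < m.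
  by rewrite /m /heightd; case: (d) Hx => /= Hx Hi; rewrite ltnS height_ge //; lia.
(* [e] is the far end of the comb containing [x]: the top [c], or [g] itself when [c = g]. *)
have main e : btw d x e g || (e == g) -> conv (12 * m + 12)
    (comb d (treap d f e)) (nd d (gapd d f x) x (comb d (treap d x e))).
  move=> He; apply: (conv_comp (k1 := 8 * m + 6) (k2 := 4 * m + 6)); last by lia.
    apply: (comb_split (x := x)); first by case: (d) Hx He => /=; lia.
    by move=> i Hi; apply: Hm; case: (d) Hi => /=; lia.
  have -> : 4 * m + 6 = (4 * m + 4).+2 by lia.
  apply: conv_near.
  by apply: conv_treap_gapd => //; case: (d) Hx => /=; lia.
have [cg|ncg] := eqVneq c g.
  rewrite cg in Ht; have -> : gapd d f g = comb d (treap d f g).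
    apply: gapd_far => [|i Hi]; first by case: (d) Hx => /=; lia.
    by apply: Ht; rewrite Hi.
  have -> : gapd d x g = comb d (treap d x g).
    apply: gapd_far => [|i Hi]; first by case: (d) Hx => /=; lia.
    by apply: Ht; case: (d) Hi Hx => /=; lia.
  by apply: conv_le (main g _); [lia|rewrite eqxx orbT].
rewrite (negbTE ncg) orbF in Hc.
rewrite (@gapd_mid d f c g) //; last by case: (d) Hx Hc => /=; lia.
rewrite (@gapd_mid d x c g) //; last first.
  by move=> i Hi; apply: Ht; case: (d) Hi Hx => /=; lia.
apply: conv_comp (conv_near _ _ _ (main c _)) (conv_rot _ _ _ _ _ _) _.
  by rewrite Hc.
lia.
Qed.

(** The side of [x] that contains the top of [[f..g]] has the larger height, so [gapd_split] started
    from the opposite end pays the smaller one. *)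
Lemma gap_split f x g : f < x < g ->
  conv (12 * minn (height f x) (height x g) + 40) (gap f g)
       (Node (gap f x) x (gap x g)).
Proof.
move=> Hx; have [|Hc Ht] := @topP f g; first lia.
move: (top f g) Hc Ht => c Hc Ht.
have [lt_cx|lt_xc|cx] := ltngtP c x.
- have le : height x g <= height f x.
    have -> : height f x = v c.
      by rewrite /height (@top_eq _ _ c) //; split=> [|i Hi]; [|apply: Ht]; lia.
    by apply/height_leP => [|i Hi]; [lia|apply: Ht; lia].
  rewrite (minn_idPr le) -[gap f g]/(gapd true g f).
  by apply: (gapd_split (d := true) (c := c)) => [||i] /=; [lia|lia|move=> ?; apply: Ht; lia].
- have le : height f x <= height x g.
    have -> : height x g = v c.
      by rewrite /height (@top_eq _ _ c) //; split=> [|i Hi]; [|apply: Ht]; lia.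
    by apply/height_leP => [|i Hi]; [lia|apply: Ht; lia].
  rewrite (minn_idPl le) -[gap f g]/(gapd false f g).
  by apply: (gapd_split (d := false) (c := c)) => [||i] /=; [lia|lia|move=> ?; apply: Ht; lia].
(* When [x] is the top, the two halves of the old gap already are the new gaps. *)
- rewrite cx in Ht => {c cx Hc}.
  rewrite -[gap f g]/(gapd false f g) (@gapd_mid false f x g) /=; first last.
  + by move=> i Hi; apply: Ht; lia.
  + lia.
  rewrite -[gap f x]/(gapd false f x) -[gap x g]/(gapd true g x) !gapd_far /=.
  + exact: conv_refl.
  + by move: Hx; lia.
  + by move=> i Hi; apply: Ht; lia.
  + by move: Hx; lia.
  + by move=> i Hi; apply: Ht; lia.
Qed.

Lemma inorder_gap f g : f < g -> inorder (gap f g) = iota f.+1 (g - f).-1.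
Proof.
move=> lt_fg; rewrite -(conv_inorder (conv_treap_gap lt_fg (ltnSn _))).
have [n] := ubnP (g - f); elim: n f g lt_fg => // n IH f g lt_fg Hn.
have [[y Hy]|no] := btw_dec false f g; last first.
  rewrite (treap_leaf no) (_ : (g - f).-1 = 0) //.
  by have := no f.+1; rewrite /=; lia.
have [r [/= Hr _ ->]] := treap_root Hy; rewrite /nd [LHS]/= !IH; try lia.
have -> : (g - f).-1 = (r - f).-1 + (g - r).-1.+1 by lia.
by rewrite iotaD /=; congr (_ ++ _); have -> : f.+1 + (r - f).-1 = r by lia.
Qed.

(** * Trees with fingers *)

(* The gaps between the fingers [fs], which lie strictly between [f] and [e],
   hang off a right comb. *)
Fixpoint fingers e f fs :=
  if fs is g :: fs' then Node (gap f g) g (fingers e g fs') else gap f e.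

Fixpoint heights e f fs :=
  if fs is g :: fs' then height f g + heights e g fs' else height f e.

(** [h] is the smaller height of the two new gaps; by [height_max] the larger is the old height. For
    a finger [y], the interval between [x] and [y] contains the new gap on that side of [x], hence
    the last bound. The term [2 * size fs1] pays for the way down the comb and back. *)
Lemma fingers_insert e x fs1 fs2 f :
  path ltn f (fs1 ++ x :: fs2) -> all (gtn e) (fs1 ++ x :: fs2) ->
  exists h, [/\ heights e f (fs1 ++ x :: fs2) = heights e f (fs1 ++ fs2) + h,
     conv (2 * size fs1 + 12 * h + 44)
            (fingers e f (fs1 ++ fs2)) (fingers e f (fs1 ++ x :: fs2))
   & forall y, y \in f :: fs1 ++ fs2 -> h <= height (minn x y) (maxn x y)].
Proof.
elim: fs1 f => [|g fs1 IH] f /=.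
  case: fs2 => [|g fs2] /=.
    move=> /andP[lt_fx _] /andP[lt_xe _]; have Hx : f < x < e by lia.
    exists (minn (height f x) (height x e)); split=> [||y].
    - by rewrite [height f e](@height_max _ x) 1?addnC ?addn_min_max; lia.
    - by apply: conv_le (gap_split Hx); lia.
    - rewrite inE => /eqP->.
      by rewrite (minn_idPr (ltnW lt_fx)) (maxn_idPl (ltnW lt_fx)) geq_minl.
  move=> /and3P[lt_fx lt_xg sfs] /and3P[lt_xe lt_ge _].
  have Hx : f < x < g by lia.
  exists (minn (height f x) (height x g)); split=> [||y].
  - by rewrite [height f g](@height_max _ x) ?maxnE ?minnE; lia.
  - by apply: conv_comp (conv_left _ _ (gap_split Hx)) (conv_rotr _ _ _ _ _) _; lia.
  - rewrite inE => /predU1P[->|Hy].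
      by rewrite (minn_idPr (ltnW lt_fx)) (maxn_idPl (ltnW lt_fx)) geq_minl.
    have le_gy : g <= y.
      move: Hy; rewrite inE => /predU1P[->//|Hy].
      by have /allP/(_ _ Hy) := order_path_min ltn_trans sfs; apply: ltnW.
    by rewrite geq_min orbC height_sub //; lia.
move=> /andP[lt_fg sfs] /andP[lt_ge lt_e].
have [h [hE cv Hh]] := IH _ sfs lt_e; exists h; split=> [||y].
- by rewrite hE addnA.
- by apply: conv_le (conv_right _ _ cv); lia.
- rewrite inE => /predU1P[->|]; last exact: Hh.
  have lt_gx : g < x.
    have /allP := order_path_min ltn_trans sfs.
    by apply; rewrite mem_cat inE eqxx orbT.
  by apply: leq_trans (Hh g (mem_head _ _)) _; apply: height_sub; lia.
Qed.

Lemma fingers_depth e f fs x : x \in fs ->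
  exists2 p, size p <= size fs & key_at (fingers e f fs) p = Some x.
Proof.
elim: fs f => // g fs IH f; rewrite inE => /predU1P[->|Hx]; first by exists [::].
by have [p sz xp] := IH g Hx; exists (true :: p).
Qed.

(** Filtering [iota 1 n] sorts [W] and removes repetitions, so the tree depends only on the set of
    fingers. *)
Definition among n (W : seq nat) := [seq i <- iota 1 n | i \in W].

(** 0 and [n.+1] are sentinels bounding the outer gaps; they are not keys of the tree. *)
Definition state n W := fingers n.+1 0 (among n W).

Definition potential n W := heights n.+1 0 (among n W).

Lemma size_among n W : size (among n W) <= size W.
Proof.
apply: uniq_leq_size; first by rewrite filter_uniq // iota_uniq.
by move=> i; rewrite mem_filter => /andP[].
Qed.

Lemma eq_among n W W' : W =i W' -> among n W = among n W'.
Proof. by move=> WW'; apply: eq_filter. Qed.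

(** A key that is already a finger changes nothing, with [h = 0]. The bound by [height 0 n.+1] is
    for the first access, which has no earlier finger. *)
Lemma state_add n x W : 0 < x <= n ->
  exists h, [/\ potential n (x :: W) = potential n W + h,
    conv (2 * size W + 12 * h + 44) (state n W) (state n (x :: W)),
    h <= height 0 n.+1
  & forall y, 0 < y <= n -> y \in W -> h <= height (minn x y) (maxn x y)].
Proof.
move=> Hx; rewrite /potential /state; have [xW|xW] := boolP (x \in W).
  have -> : among n (x :: W) = among n W.
    by apply: eq_among => i; rewrite inE; case: eqVneq => // ->.
  by exists 0; rewrite addn0; split=> //; apply: conv_refl.
have nE : iota 1 n = iota 1 x.-1 ++ x :: iota x.+1 (n - x).
  have -> : n = x.-1 + (n - x).+1 by lia.
  rewrite iotaD /=; congr (_ ++ _ :: iota _ _); lia.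
set fs1 := [seq i <- iota 1 x.-1 | i \in W].
set fs2 := [seq i <- iota x.+1 (n - x) | i \in W].
have E1 : among n W = fs1 ++ fs2.
  by rewrite /among nE filter_cat /= (negbTE xW).
have E2 : among n (x :: W) = fs1 ++ x :: fs2.
  rewrite /among nE filter_cat /= mem_head.
  congr (_ ++ _ :: _); apply: eq_in_filter => i; rewrite mem_iota inE => Hi;
    by case: eqVneq => // ?; lia.
have sorted_n : path ltn 0 (among n (x :: W)).
  rewrite path_min_sorted; last by apply/allP=> i; rewrite mem_filter mem_iota; lia.
  by apply: sorted_filter (iota_ltn_sorted _ _); apply: ltn_trans.
have lt_n : all (gtn n.+1) (among n (x :: W)).
  by apply/allP => i; rewrite mem_filter mem_iota /=; lia.
rewrite E2 in sorted_n lt_n; have [h [hE cv Hh]] := fingers_insert sorted_n lt_n.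
exists h; rewrite E1 E2; split=> // [||y Hy yW].
- apply: conv_le cv; rewrite !leq_add2r leq_mul2l /=.
  by apply: leq_trans (size_among n W); rewrite E1 size_cat leq_addr.
- by apply: leq_trans (Hh 0 (mem_head _ _)) _; apply: height_sub; lia.
- by apply: Hh; rewrite inE -E1 mem_filter yW mem_iota; lia.
Qed.

(* Serving [x] inserts the finger [x], then removes the oldest finger by
   running an insertion backwards, which gives back its potential. *)
Lemma exec_state l n X b : 0 < l -> all (fun x => 1 <= x <= n) X ->
  (forall t, 1 <= t <= size X ->
     (t = 1 /\ height 0 n.+1 <= b t) \/
     exists2 t', (1 <= t' < t) && (t <= t' + l) &
       height (minn (acc X t) (acc X t')) (maxn (acc X t) (acc X t')) <= b t) ->
  forall suf pre, X = pre ++ suf ->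
  exists2 c, exec (state n (take l (rev pre))) suf c
    & c <= 12 * potential n (take l (rev pre)) +
           \sum_((size pre).+1 <= t < (size X).+1) (5 * l + 89 + 24 * b t).
Proof.
move=> l_gt0 Xn Hb; elim=> [|x suf IH] pre XE; first by exists 0.
have Hx : 0 < x <= n by have /allP -> // := Xn; rewrite XE mem_cat mem_head orbT.
have [] := IH (rcons pre x); first by rewrite cat_rcons.
(* [W] is the window before the access; [W'] is [W] without its oldest entry once the window is
   full. *)
set W := take l (rev pre); set W' := take l.-1 (rev pre).
have -> : take l (rev (rcons pre x)) = x :: W' by rewrite rev_rcons /W'; case: (l) l_gt0.
move=> c exec_c le_c.
have szW : size W <= l by rewrite size_take_min geq_minl.
have szW' : size W' < l by rewrite size_take_min; lia.
have [h [hE cv h_top Hh]] := state_add W Hx.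
have le_hb : h <= b (size pre).+1.
  have accx : acc X (size pre).+1 = x by rewrite XE /acc nth_cat ltnn subnn.
  have [|[_ le_b]|[t' Ht' le_b]] := Hb (size pre).+1.
  - by rewrite XE size_cat /=; lia.
  - exact: leq_trans le_b.
  apply: leq_trans le_b; rewrite accx; apply: Hh.
    have /allP -> // := Xn; apply: mem_nth; rewrite XE size_cat /=; lia.
  (* Time [t'] is at index [size pre - t'] of the reversed prefix. *)
  have lt : size pre - t' < size W by rewrite size_take_min size_rev leq_min; lia.
  have -> : acc X t' = nth 0 W (size pre - t').
    rewrite nth_take ?nth_rev /acc ?XE ?nth_cat; try lia.
    rewrite ifT; [congr nth|]; lia.
  exact: mem_nth.
(* [h'] is the potential released by dropping the oldest entry; it is 0 while the window is not
   full. *)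
have [h' [hE' cv']] : exists h', potential n (x :: W') + h' = potential n W + h /\
    conv (2 * l + 12 * h' + 44) (state n (x :: W)) (state n (x :: W')).
  have [le_pl|lt_lp] := leqP (size pre) l.-1.
    have -> : W' = W by rewrite /W /W' !take_oversize ?size_rev //; lia.
    by exists 0; rewrite addn0; split=> //; apply: conv_refl.
  pose y := nth 0 (rev pre) l.-1.
  have WE : W = rcons W' y by rewrite /W' /y -take_nth ?size_rev // prednK.
  have Hy : 0 < y <= n.
    by have /allP -> // := Xn; rewrite XE mem_cat -mem_rev mem_nth // size_rev.
  have [h' [hE' cv' _ _]] := state_add (x :: W') Hy.
  have E : x :: W =i y :: x :: W'.
    by move=> i; rewrite WE !inE mem_rcons inE orbCA.
  exists h'; split; first by rewrite -hE' -hE /potential (eq_among n E).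
  apply: conv_sym; rewrite /state (eq_among n E).
  by apply: conv_le cv'; rewrite /=; lia.
have [p szp xp] : exists2 p, size p <= size (among n (x :: W'))
    & key_at (state n (x :: W')) p = Some x.
  by apply: fingers_depth; rewrite mem_filter mem_head mem_iota; lia.
have [cs [srv szcs lastcs]] := serves_conv (conv_trans cv cv') xp.
exists ((size cs).+1 + c).
  by exists cs; split=> //; exists c; rewrite lastcs.
rewrite big_ltn; last by rewrite XE size_cat addnS !ltnS leq_addr.
rewrite size_rcons in le_c.
have /= := size_among n (x :: W').
(* The access costs at most [2 * l + 12 * h + 44] to insert, [2 * l + 12 * h' + 44] to remove, [l]
   to reach [x], and 1. By [hE] and [hE'], [12 * h'] is [12 * h] plus 12 times the drop of potential
   from [W] to [x :: W']. *)
move: (\sum_(_ <= t < _) _) le_c szcs szp szW szW' hE hE' le_hb => S.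
move: (size cs) (size p) (size W) (size W') (size (among _ _)) => s1 s2 s3 s4 s5.
move: (b _) (potential _ _) (potential _ _) => b0 p1 p2.
clear. lia.
Qed.

End Level.

(** * Shifted dyadic levels *)

Definition level s i := logn 2 (i + s).

(** With [e] the common level, [a + s] and [b + s] are distinct odd multiples of [2 ^ e]; the even
    multiple just after [a + s] lies strictly between them and has a higher level. *)
Lemma level_between s a b : 0 < s -> a < b -> level s a = level s b ->
  exists2 c, a < c < b & level s a < level s c.
Proof.
rewrite /level => s_gt0 lt_ab; set e := logn 2 (a + s) => Ee.
have pos i : 0 < i + s by lia.
have dvd i j : (2 ^ j %| i + s) = (j <= logn 2 (i + s)) by apply: pfactor_dvdn.
have /dvdnP[p Ep] : 2 ^ e %| a + s by rewrite dvd.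
have /dvdnP[q Eq] : 2 ^ e %| b + s by rewrite dvd -Ee.
have Np : odd p.
  have : ~~ (2 ^ e.+1 %| a + s) by rewrite dvd ltnn.
  by rewrite Ep expnS dvdn_pmul2r ?expn_gt0 // dvdn2 negbK.
have Nq : odd q.
  have : ~~ (2 ^ e.+1 %| b + s) by rewrite dvd -Ee ltnn.
  by rewrite Eq expnS dvdn_pmul2r ?expn_gt0 // dvdn2 negbK.
have e_gt0 : 0 < 2 ^ e by rewrite expn_gt0.
have lt_pq : p < q by rewrite -(ltn_pmul2r e_gt0) -Ep -Eq ltn_add2r.
have lt_p1q : p.+1 < q.
  by rewrite ltn_neqAle lt_pq andbT; apply/eqP => E; rewrite -E /= Np in Nq.
have lt_cb : a + 2 ^ e + s < b + s.
  by rewrite addnAC Ep Eq -mulSnr ltn_pmul2r.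
exists (a + 2 ^ e); first by lia.
by rewrite -dvd addnAC Ep -mulSnr expnS dvdn_pmul2r // dvdn2 /= negbK.
Qed.

Lemma leq_sum_nat m n (F1 F2 : nat -> nat) :
  (forall i, m <= i < n -> F1 i <= F2 i) ->
  \sum_(m <= i < n) F1 i <= \sum_(m <= i < n) F2 i.
Proof. by move=> F12; rewrite big_nat [leqRHS]big_nat; apply: leq_sum. Qed.

(** Compare the number of multiples of [q] up to [i + N] with the number up to [i]. *)
Lemma sum_dvd_shift q N i : 0 < q -> q %| N ->
  \sum_(1 <= s < N.+1) (q %| i + s) = N %/ q.
Proof.
move=> q_gt0 qN; apply: (@addnI (i %/ q)).
rewrite -(divnDr _ qN) !divn_count_dvd.
rewrite [RHS](big_cat_nat (n := i.+1)) //=; last by rewrite ltnS leq_addr.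
congr (_ + _); rewrite -[i.+1 in RHS]add1n big_addn.
have -> : (i + N).+1 - i = N.+1 by lia.
by apply: eq_bigr => s _; rewrite addnC.
Qed.

Lemma sum_pow2 L k : \sum_(L.+1 <= j < (L + k).+1) 2 ^ (L + k - j) < 2 ^ k.
Proof.
elim: k L => [|k IH] L; first by rewrite addn0 big_geq.
rewrite big_ltn; last by lia.
have -> : L + k.+1 - L.+1 = k by lia.
by have := IH L.+1; rewrite addSnnS expnS; lia.
Qed.

(** A level is the number of [j >= 1] with [2 ^ j] dividing [i + s]; the size bound leaves only
    [j <= M]. *)
Lemma level_excess s i L M : 0 < s -> i + s < 2 ^ M.+1 ->
  level s i - L <= \sum_(L.+1 <= j < M.+1) (2 ^ j %| i + s).
Proof.
move=> s_gt0 lt_M; have pos : 0 < i + s by lia.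
rewrite (eq_bigr (fun j => nat_of_bool (j <= level s i))); last first.
  by move=> j _; rewrite pfactor_dvdn.
have le_M : level s i <= M.
  have : 2 ^ level s i <= i + s by apply: dvdn_leq => //; apply: pfactor_dvdnn.
  by move=> le; have := leq_ltn_trans le lt_M; rewrite ltn_exp2l.
have [le_L|lt_L] := leqP (level s i) L; first by rewrite (eqP le_L).
rewrite (big_cat_nat (n := (level s i).+1)) //=; last by lia.
rewrite (eq_big_nat _ _ (F2 := fun=> 1)); last by move=> j; lia.
by rewrite sum_nat_const_nat; lia.
Qed.

(** Averaged over [s], a fixed key has excess over [L] at most the sum of [2 ^ -j] over [j > L],
    which is at most [2 ^ -L]. There are at most [2 ^ L] keys, so the mean height is at most
    [L + 1]. *)
Lemma sum_height M L a b : a <= b -> b < 2 ^ M -> b - a < 2 ^ L ->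
  \sum_(1 <= s < (2 ^ M).+1) height (level s) a b <= 2 ^ M * L.+1.
Proof.
move=> le_ab lt_b lt_ba; set N := 2 ^ M.
(* The top [c] alone would do, but it depends on [s]; summing over all keys allows exchanging the
   sums. *)
have H s : 1 <= s < N.+1 -> height (level s) a b <=
    L + \sum_(a <= i < b.+1) \sum_(L.+1 <= j < M.+1) (2 ^ j %| i + s).
  move=> Hs; have [Hc _] := topP (level s) le_ab.
  rewrite /height; move: (top _ a b) Hc => c Hc.
  rewrite -leq_subLR (big_cat_nat (n := c)) /=; try lia.
  rewrite addnC big_ltn; last by lia.
  rewrite -addnA; apply: leq_trans (leq_addr _ _).
  by apply: level_excess; rewrite ?expnS -/N; lia.
apply: leq_trans (leq_sum_nat H) _.
rewrite big_split /= sum_nat_const_nat subn1 /= mulnS addnC leq_add2r.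
rewrite exchange_big_nat /=.
have step i : \sum_(1 <= s < N.+1) \sum_(L.+1 <= j < M.+1) (2 ^ j %| i + s) <=
    N %/ 2 ^ L.
  rewrite exchange_big_nat /=.
  have [lt_ML|le_LM] := ltnP M L; first by rewrite big_geq //; lia.
  rewrite /N -expnB //; apply: leq_trans (ltnW (sum_pow2 L _)).
  rewrite subnKC //; apply: leq_sum_nat => j Hj.
  by rewrite sum_dvd_shift ?expn_gt0 ?dvdn_exp2l ?expnB //; lia.
apply: leq_trans (leq_sum _ _) _; first by move=> i _; exact: step.
rewrite sum_nat_const_nat; apply: leq_trans (leq_divM N (2 ^ L)).
by rewrite mulnC leq_mul2l; apply/orP; right; lia.
Qed.

Lemma height_level_le M s n : 0 < s <= 2 ^ M -> n < 2 ^ M ->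
  height (level s) 0 n <= M.
Proof.
move=> Hs lt_n; apply/height_leP => // i Hi; rewrite -subn_eq0 -leqn0.
apply: leq_trans (level_excess (M := M) _ _ _) _; rewrite ?big_geq //; try lia.
by rewrite expnS; lia.
Qed.

(** One shift must serve the whole sequence: if every [s] exceeded the total of [B], so would the
    mean. *)
Lemma averaging (F : nat -> nat -> nat) (B : nat -> nat) N m : 0 < N ->
  (forall t, 1 <= t < m -> \sum_(1 <= s < N.+1) F s t <= N * B t) ->
  exists2 s, 0 < s <= N & \sum_(1 <= t < m) F s t <= \sum_(1 <= t < m) B t.
Proof.
move=> N_gt0 FB; set C := \sum_(1 <= t < m) B t.
have [/hasP[s]|/hasPn no] := boolP (has (fun s => \sum_(1 <= t < m) F s t <= C) (iota 1 N)).
  by rewrite mem_iota => Hs le_C; exists s => //; lia.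
have : \sum_(1 <= s < N.+1) C.+1 <= N * C.
  rewrite /C big_distrr /=; apply: leq_trans (leq_sum_nat FB).
  rewrite exchange_big_nat /=; apply: leq_sum_nat => s Hs.
  by rewrite ltnNge; apply: no; rewrite mem_iota; lia.
by rewrite sum_nat_const_nat subn1 leq_mul2l ltnn; lia.
Qed.

(** * The bound *)

Lemma OPT_le n X c : opt_cost n X c -> OPT n X <= c.
Proof.
move=> Hc; rewrite /OPT; case: excluded_middle_informative => // ex.
case: ex_minnP => k _; apply; rewrite /opt_costb.
by case: excluded_middle_informative.
Qed.

Lemma distnE a b : distn a b = maxn a b - minn a b.
Proof. by rewrite /distn; lia. Qed.

Lemma OPT_window l n X (B p : nat -> nat) M : 0 < l ->
  all (fun x => 1 <= x <= n) X -> n.+1 < 2 ^ M ->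
  (0 < size X -> M <= B 1) ->
  (forall t, 1 < t <= size X ->
     (1 <= p t < t) && (t <= p t + l) &&
     (distn (acc X t) (acc X (p t)) < 2 ^ (B t).-1) && (0 < B t)) ->
  OPT n X <= \sum_(1 <= t < (size X).+1) (5 * l + 89 + 36 * B t).
Proof.
move=> l_gt0 Xn lt_nM B1 Bp.
pose a t := minn (acc X t) (acc X (p t)); pose e t := maxn (acc X t) (acc X (p t)).
(* [M] bounds the height of the whole range for every shift; it covers the first access and also the
   initial potential. *)
pose F s (t : nat) := if t == 1 then M else height (level s) (a t) (e t).
have accn t : 1 <= t <= size X -> 1 <= acc X t <= n.
  by case: t => // t Ht; have /allP -> // := Xn; apply: mem_nth.
have FB t : 1 <= t < (size X).+1 ->
    \sum_(1 <= s < (2 ^ M).+1) F s t <= 2 ^ M * B t.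
  rewrite /F => Ht; case: eqP => [t1|nt1].
    by rewrite sum_nat_const_nat subn1 leq_mul2l t1 B1 ?orbT //; lia.
  have /Bp/andP[/andP[/andP[Hp Hl] Hd] B_gt0] : 1 < t <= size X by lia.
  rewrite -(prednK B_gt0); apply: sum_height; rewrite -?distnE //.
    by rewrite geq_min leq_max leqnn.
  have /andP[_ ?] : 1 <= acc X t <= n by apply: accn; lia.
  have /andP[_ ?] : 1 <= acc X (p t) <= n by apply: accn; lia.
  by rewrite /e gtn_max; lia.
have [s Hs le_F] := averaging (expn_gt0 2 M : 0 < 2 ^ M) FB.
have Hv : forall i j, i < j -> level s i = level s j ->
    exists2 c, i < c < j & level s i < level s c.
  by move=> i j; apply: level_between; case/andP: Hs.
have top_le : height (level s) 0 n.+1 <= M by apply: height_level_le.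
have [|c Xc le_c] := exec_state (b := F s) Hv l_gt0 Xn _ (erefl X : X = [::] ++ X).
  move=> t Ht; rewrite /F; case: eqP => [t1|nt1]; [by left|right].
  have /Bp/andP[/andP[/andP[Hp Hl] _] _] : 1 < t <= size X by lia.
  by exists (p t); rewrite ?Hp.
have is_bst0 : is_bst n (state (level s) n [::]).
  by rewrite /is_bst /state /among filter_pred0 /= inorder_gap // subn0.
have le_OPT : OPT n X <= c by apply: OPT_le; exists (state (level s) n [::]).
have [/size0nil X0|X_gt0] := posnP (size X).
  by move: Xc le_OPT; rewrite X0 /= => ->; rewrite leqn0 => /eqP->.
have le_pot : potential (level s) n [::] <= \sum_(1 <= t < (size X).+1) F s t.
  rewrite /potential /among filter_pred0 /=; apply: leq_trans top_le _.
  by rewrite big_ltn // /F eqxx leq_addr.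
apply: leq_trans le_OPT (leq_trans le_c _).
have sumE k (G : nat -> nat) :
    \sum_(1 <= t < (size X).+1) (5 * l + 89 + k * G t) =
    size X * (5 * l + 89) + k * \sum_(1 <= t < (size X).+1) G t.
  by rewrite big_split big_distrr /= sum_nat_const_nat subn1.
(* 36 is 24 from the accesses plus 12 from the initial potential. *)
rewrite !sumE; move: (_ * (_ + 89)) (\sum_(_ <= t < _) F s t) le_pot le_F => q f.
by move: (\sum_(_ <= t < _) B t) (potential _ _ _) => g r; lia.
Qed.

(** * Logarithms and the terms of [UB] *)

Open Scope R_scope.

Lemma INR_expn k : INR (2 ^ k)%N = 2 ^ k.
Proof. by elim: k => // k IH; rewrite expnS mult_INR IH. Qed.

Lemma ln_le x y : 0 < x -> x <= y -> ln x <= ln y.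
Proof.
move=> x_gt0 [lt_xy|->]; last exact: Rle_refl.
by apply: Rlt_le; apply: ln_increasing.
Qed.

Lemma lg_ge1 x : 1 <= lg x.
Proof.
have ln2 := ln_lt_2; apply: (Rmult_le_reg_r (ln 2)); first lra.
rewrite /lg /Rdiv Rmult_assoc Rinv_l; last by lra.
by rewrite Rmult_1_l Rmult_1_r; apply: ln_le; [lra|apply: Rmax_l].
Qed.

Lemma lg_le x y : x <= y -> lg x <= lg y.
Proof.
move=> le_xy; have ln2 := ln_lt_2; apply: Rmult_le_compat_r.
  by apply: Rlt_le; apply: Rinv_0_lt_compat; lra.
apply: ln_le; first by have := Rmax_l 2 x; lra.
exact: Rle_max_compat_l.
Qed.

Lemma lg_pow2 k n : (2 ^ k <= 2 * n)%N -> INR k <= 1 + lg (INR n).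
Proof.
move=> /leP/le_INR; rewrite INR_expn mult_INR => le_k.
have ln2 := ln_lt_2; have max_gt0 : 0 < Rmax 2 (INR n) by have := Rmax_l 2 (INR n); lra.
apply: (Rmult_le_reg_r (ln 2)); first lra.
rewrite Rmult_plus_distr_r /lg /Rdiv Rmult_assoc Rinv_l; last by lra.
rewrite Rmult_1_l Rmult_1_r -ln_pow; last by lra.
rewrite -ln_mult //; last by lra.
apply: ln_le; first by apply: pow_lt; lra.
by have := Rmax_r 2 (INR n); move: le_k; rewrite /=; lra.
Qed.

Lemma foldr_Rmin_attained (T : Type) (f : T -> R) t0 ts :
  exists2 t, List.In t (t0 :: ts) & foldr (fun t acc => Rmin (f t) acc) (f t0) ts = f t.
Proof.
elim: ts => [|t ts [u Hu IH]] /=; first by exists t0; [left|].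
rewrite IH /Rmin; case: Rle_dec => _; first by exists t; [right; left|].
by exists u => //; case: Hu => [->|Hu]; [left|right; right].
Qed.

Lemma INR_sum_le (F : nat -> nat) (G : nat -> R) C (r : seq nat) :
  (forall t, t \in r -> INR (F t) <= C * G t) ->
  INR (\sum_(t <- r) F t) <= C * \big[Rplus/0]_(t <- r) G t.
Proof.
elim: r => [|t r IH] FG; first by rewrite !big_nil /=; lra.
rewrite !big_cons plus_INR Rmult_plus_distr_l.
apply: Rplus_le_compat; first by apply: FG; rewrite mem_head.
by apply: IH => u Hu; apply: FG; rewrite inE Hu orbT.
Qed.

Lemma ub_term_attained l n X t : (0 < l)%N -> (1 < t)%N ->
  exists2 t', (1 <= t' < t)%N && (t <= t' + l)%N &
    lg (INR (distn (acc X t) (acc X t'))) <= ub_term l n X t.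
Proof.
move=> l_gt0 t_gt1; rewrite /ub_term.
(* The preceding access is in the window, so the minimum is over a nonempty list. *)
have tw : t.-1 \in [seq t' <- iota 1 t.-1 | (t <= t' + l)%N].
  by rewrite mem_filter mem_iota; lia.
case E: [seq t' <- iota 1 t.-1 | (t <= t' + l)%N] tw => [//|t0 ts] _.
have [t' Ht' fE] := foldr_Rmin_attained
  (fun t' => lg (INR (distn (acc X t) (acc X t') + rho X t (acc X t')))) t0 ts.
exists t'; last first.
  apply: Rle_trans (Req_le _ _ (esym fE)).
  by apply: lg_le; apply: le_INR; apply/leP; rewrite leq_addr.
have : t' \in t0 :: ts.
  elim: (t0 :: ts) Ht' => //= u us IH [->|/IH]; rewrite inE ?eqxx // => ->.
  by rewrite orbT.
by rewrite -E mem_filter mem_iota; lia.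
Qed.

Lemma ub_term_ge1 l n X t : 1 <= ub_term l n X t.
Proof.
rewrite /ub_term; case: filter => [|t0 ts]; first exact: lg_ge1.
have [t' _ fE] := foldr_Rmin_attained
  (fun t' => lg (INR (distn (acc X t) (acc X t') + rho X t (acc X t')))) t0 ts.
by apply: Rle_trans (Req_le _ _ (esym fE)); apply: lg_ge1.
Qed.

Theorem theorem1 :
  exists beta : nat -> nat,
    forall (l n m : nat) (X : seq nat),
      (1 <= l)%N -> (n <= m)%N -> size X = m ->
      all (fun x => (1 <= x <= n)%N) X ->
      Rle (INR (OPT n X)) (Rmult (INR (beta l)) (UB l n X)).
Proof.
(* 233 is 89 + 36 * 4, with 4 from [le_B]; the part [5 * l + 89] is absorbed because each term of
   [UB] is at least 1. *)
exists (fun l => 5 * l + 233)%N => l n _ X l_gt0 _ _ Xn.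
pose close t t' := (1 < t)%N -> (1 <= t' < t)%N && (t <= t' + l)%N /\
  lg (INR (distn (acc X t) (acc X t'))) <= ub_term l n X t.
have [p Hp] : exists p : nat -> nat, forall t, close t (p t).
  apply: functional_choice => t; rewrite /close.
  have [t_gt1|] := ltnP 1 t; last by exists 0%N.
  by have [t' ? ?] := ub_term_attained n X l_gt0 t_gt1; exists t'.
(* [B 1] equals the [M] used below. For later [t], [(B t).-1] is the strict exponent
   [trunc_log + 1], valid also at distance 0. *)
pose B t := if t == 1%N then (trunc_log 2 n.+1).+1
            else (trunc_log 2 (distn (acc X t) (acc X (p t)))).+2.
have le_B t : (t \in index_iota 1 (size X).+1) -> INR (B t) <= 4 * ub_term l n X t.
  rewrite mem_index_iota /B => Ht; case: eqP => [->|nt1].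
    have -> : ub_term l n X 1 = lg (INR n) by [].
    have n_gt0 : (0 < n)%N.
      have X_gt0 : (0 < size X)%N by have /andP[] := Ht; apply: leq_trans.
      have /allP/(_ _ (mem_nth 0%N X_gt0)) := Xn; lia.
    have /lg_pow2 : (2 ^ trunc_log 2 n.+1 <= 2 * n)%N.
      by apply: leq_trans (trunc_logP _ _) _; lia.
    by have := lg_ge1 (INR n); rewrite S_INR; lra.
  have /andP[t_gt0 _] := Ht; have t_gt1 : (1 < t)%N by lia.
  have [_] := Hp t t_gt1.
  move: (distn _ _) => d le_ub.
  have [d0|d_gt0] := posnP d.
    by rewrite d0 /=; have := ub_term_ge1 l n X t; lra.
  have /lg_pow2 : (2 ^ trunc_log 2 d <= 2 * d)%N.
    by apply: leq_trans (trunc_logP _ _) _; lia.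
  by rewrite !S_INR; have := ub_term_ge1 l n X t; lra.
have le_OPT : (OPT n X <= \sum_(1 <= t < (size X).+1) (5 * l + 89 + 36 * B t))%N.
  apply: (OPT_window (p := p) (M := (trunc_log 2 n.+1).+1)) => // [|t Ht].
    exact: trunc_log_ltn.
  have /andP[t_gt1 _] := Ht; have [-> _] := Hp t t_gt1.
  rewrite /B ifF; last by lia.
  by rewrite /= trunc_log_ltn.
apply: Rle_trans (le_INR _ _ (leP le_OPT)) _.
apply: INR_sum_le => t Ht; have := le_B t Ht; have := ub_term_ge1 l n X t.
have INR_add a b : INR (a + b)%N = INR a + INR b by apply: plus_INR.
have INR_mul a b : INR (a * b)%N = INR a * INR b by apply: mult_INR.
rewrite (INR_add _ (36 * _)%N) !(INR_add (5 * l)%N) !INR_mul.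
rewrite !(INR_IZR_INZ 5, INR_IZR_INZ 89, INR_IZR_INZ 36, INR_IZR_INZ 233) /=.
move: (ub_term l n X t) (INR (B t)) (INR l) (pos_INR l) => u b L L_ge0 u_ge1 le_b.
by have := Rmult_le_compat_l L 1 u L_ge0 u_ge1; lra.
Qed.
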